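(* For all integers $n\ge 2$ and $k\ge 1$ we have $$\int_{-1}^1 \left(L_k + F_k x\sqrt5\right)^{n-2} x\,dx = \frac{2^n}{(n-1)\sqrt5\,F_k}\left(\frac{L_{(n-1)k}}{2} - \frac{F_{nk}}{nF_k}\right).$$
   Context: The Fibonacci numbers are $F_0=0$, $F_1=1$, $F_n=F_{n-1}+F_{n-2}$, and the Lucas numbers are $L_0=2$, $L_1=1$, $L_n=L_{n-1}+L_{n-2}$. *)

(* Defs.v *)
From Stdlib Require Import Reals.
From Coquelicot Require Import Coquelicot.

Fixpoint fib (n : nat) : nat :=
  match n with
  | O => 0
  | S m => match m with
           | O => 1
           | S p => fib m + fib p
           end
  end.

Fixpoint lucas (n : nat) : nat :=
  match n with
  | O => 2
  | S m => match m with
           | O => 1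
           | S p => lucas m + lucas p
           end
  end.

(* Main.v *)
Require Import Defs.
From Stdlib Require Import Reals Lra Lia.
From Coquelicot Require Import Coquelicot.
Open Scope R_scope.

(** By Binet, [L_k = A + B] and [sqrt 5 * F_k = A - B] with [A = phi^k] and
    [B = psi^k], so the affine base [u] of the integrand runs from [2 B] to
    [2 A].  As [x = (u - (A + B)) / (A - B)], the integral is elementary, and
    [(A + B)(A^(n-1) - B^(n-1)) + (A - B)(A^(n-1) + B^(n-1)) = 2 (A^n - B^n)]
    puts it in the claimed form. *)

Definition phi : R := (1 + sqrt 5) / 2.
Definition psi : R := (1 - sqrt 5) / 2.

Lemma sqrt5_sqr : sqrt 5 * sqrt 5 = 5.
Proof. apply sqrt_sqrt; lra. Qed.

Lemma phi_sqr : phi * phi = phi + 1.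
Proof. unfold phi; generalize sqrt5_sqr; lra. Qed.

Lemma psi_sqr : psi * psi = psi + 1.
Proof. unfold psi; generalize sqrt5_sqr; lra. Qed.

Lemma fib_SS (k : nat) : fib (S (S k)) = (fib (S k) + fib k)%nat.
Proof. reflexivity. Qed.

Lemma lucas_SS (k : nat) : lucas (S (S k)) = (lucas (S k) + lucas k)%nat.
Proof. reflexivity. Qed.

(** Powers of either root of [x * x = x + 1] obey the Fibonacci recurrence, which drives both Binet
    formulas. *)
Lemma pow_SS_of_sqr (x : R) (k : nat) :
  x * x = x + 1 -> x ^ S (S k) = x ^ S k + x ^ k.
Proof.
intros Hx; simpl; rewrite <- Rmult_assoc, Hx; ring.
Qed.

Lemma fib_binet (k : nat) : INR (fib k) * sqrt 5 = phi ^ k - psi ^ k.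
Proof.
(* The recurrence reaches back two terms, so the induction carries two consecutive indices. *)
enough (INR (fib k) * sqrt 5 = phi ^ k - psi ^ k /\
        INR (fib (S k)) * sqrt 5 = phi ^ S k - psi ^ S k) by tauto.
induction k as [|k [IH0 IH1]].
- unfold phi, psi; simpl; lra.
- split; [exact IH1|].
  rewrite fib_SS, plus_INR, (pow_SS_of_sqr _ _ phi_sqr), (pow_SS_of_sqr _ _ psi_sqr).
  lra.
Qed.

Lemma lucas_binet (k : nat) : INR (lucas k) = phi ^ k + psi ^ k.
Proof.
enough (INR (lucas k) = phi ^ k + psi ^ k /\
        INR (lucas (S k)) = phi ^ S k + psi ^ S k) by tauto.
induction k as [|k [IH0 IH1]].
- unfold phi, psi; simpl; lra.
- split; [exact IH1|].
  rewrite lucas_SS, plus_INR, (pow_SS_of_sqr _ _ phi_sqr), (pow_SS_of_sqr _ _ psi_sqr).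
  lra.
Qed.

Lemma fib_pos (k : nat) : (1 <= k)%nat -> (0 < fib k)%nat.
Proof.
destruct k as [|k]; [lia|intros _].
induction k as [|k IH]; [simpl; lia|rewrite fib_SS; lia].
Qed.

Lemma is_RInt_affine_pow_mul_id (A B : R) (m : nat) : A <> B ->
  is_RInt (fun x => (A + B + (A - B) * x) ^ m * x) (-1) 1
    (2 ^ (m + 2) / (INR (m + 1) * (A - B)) *
     ((A ^ (m + 1) + B ^ (m + 1)) / 2
      - (A ^ (m + 2) - B ^ (m + 2)) / (INR (m + 2) * (A - B)))).
Proof.
intros HAB.
assert (Hd : A - B <> 0) by lra.
assert (H1 : INR (m + 1) <> 0) by (apply not_0_INR; lia).
assert (H2 : INR (m + 2) <> 0) by (apply not_0_INR; lia).
pose (u := fun x : R => A + B + (A - B) * x).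
(* Primitive of [u ^ m * x]: one factor [A - B] comes from writing [x] in terms of [u], the other
   from [du = (A - B) dx]. *)
pose (G := fun x : R =>
  (u x ^ (m + 2) / INR (m + 2) - (A + B) * u x ^ (m + 1) / INR (m + 1))
  / (A - B) ^ 2).
assert (HG : forall x, is_derive G x (u x ^ m * x)).
{ intros x; unfold G, u; auto_derive; [exact I|].
  replace (Init.Nat.pred (m + 2)) with (S m) by lia.
  replace (Init.Nat.pred (m + 1)) with m by lia.
  simpl pow; field; auto. }
replace (2 ^ (m + 2) / _ * _) with (minus (G 1) (G (-1))).
- apply (is_RInt_derive (V := R_CompleteNormedModule) G); intros x _; [apply HG|].
  apply (ex_derive_continuous (fun x : R => u x ^ m * x)).
  unfold u; auto_derive; exact I.
- unfold minus, plus, opp, G; simpl.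
  replace (u 1) with (2 * A) by (unfold u; ring).
  replace (u (-1)) with (2 * B) by (unfold u; ring).
  rewrite !Rpow_mult_distr.
  (* The two forms agree only because [1 / (m + 2) + 1 / ((m + 1) * (m + 2)) = 1 / (m + 1)], so
     [field] must see how the two denominators are related. *)
  assert (H3 : INR (m + 2) = INR (m + 1) + 1)
    by (rewrite !plus_INR; simpl; ring).
  rewrite H3 in *.
  replace (m + 2)%nat with (S (S m)) by lia.
  replace (m + 1)%nat with (S m) by lia.
  replace (m + 1)%nat with (S m) in H1, H2 by lia.
  simpl pow; field; auto.
Qed.

Theorem corollary2 (n k : nat) (hn : (2 <= n)%nat) (hk : (1 <= k)%nat) :
  is_RInt
    (fun x : R => (INR (lucas k) + INR (fib k) * x * sqrt 5) ^ (n - 2) * x)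
    (-1) 1
    (2 ^ n / (INR (n - 1) * sqrt 5 * INR (fib k)) *
     (INR (lucas ((n - 1) * k)) / 2 - INR (fib (n * k)) / (INR n * INR (fib k)))).
Proof.
assert (Hs : 0 < sqrt 5) by (apply sqrt_lt_R0; lra).
assert (Hf : 0 < INR (fib k)) by (apply lt_0_INR, fib_pos, hk).
assert (HF := fib_binet k).
(* The difference is [sqrt 5] times [fib k], positive because [k >= 1]. *)
assert (Hd : phi ^ k <> psi ^ k).
{ assert (0 < INR (fib k) * sqrt 5) by (apply Rmult_lt_0_compat; assumption).
  lra. }
assert (HI := is_RInt_affine_pow_mul_id _ _ (n - 2) Hd).
replace (n - 2 + 2)%nat with n in HI by lia.
replace (n - 2 + 1)%nat with (n - 1)%nat in HI by lia.
(* Binet is read backwards, first at index [k], then at [(n - 1) * k] and [n * k] once the nested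
   powers are merged. *)
rewrite <- HF, <- lucas_binet, <- !pow_mult, (Nat.mul_comm k n),
  (Nat.mul_comm k (n - 1)), <- lucas_binet, <- fib_binet in HI.
assert (INR n <> 0) by (apply not_0_INR; lia).
assert (INR (n - 1) <> 0) by (apply not_0_INR; lia).
(* The [sqrt 5] from Binet cancels in the last quotient and survives only in the prefactor. *)
replace (2 ^ n / _ * _) with
  (2 ^ n / (INR (n - 1) * (INR (fib k) * sqrt 5)) *
   (INR (lucas ((n - 1) * k)) / 2
    - INR (fib (n * k)) * sqrt 5 / (INR n * (INR (fib k) * sqrt 5))))
  by (field; repeat split; lra).
apply is_RInt_ext with (2 := HI).
intros x _; f_equal; f_equal; ring.
Qed.
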